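(* Let $\mathbf{H}\in\mathbb{C}^{B\times U}$ have full column rank $U$, let $\mathbf{j}\in\mathbb{C}^{B}$ not lie in the column space of $\mathbf{H}$, let $\mathbf{S}_T\in\mathbb{C}^{U\times T}$ have full row rank $U$, let $\mathbf{S}_D\in\mathcal{S}^{U\times D}$, and let $\mathbf{w}\in\mathbb{C}^{T+D}$ with $\mathbf{w}^{\mathrm T}=[\mathbf{w}_T^{\mathrm T},\mathbf{w}_D^{\mathrm T}]$, $\mathbf{w}_T\in\mathbb{C}^T$, $\mathbf{w}_D\in\mathbb{C}^D$. Put $\mathbf{S}=[\mathbf{S}_T,\mathbf{S}_D]$ and let the (noiseless) receive matrix be $$\mathbf{Y}=\mathbf{H}\mathbf{S}+\mathbf{j}\mathbf{w}^{\mathrm T}.$$ Let $\mathbf{p}=\mathbf{j}/\|\mathbf{j}\|_2$ and $\mathbf{P}=\mathbf{I}_B-\mathbf{p}\mathbf{p}^{\mathrm H}$. Suppose that the jammer is not eclipsed. Then the optimization problem $$\min_{\tilde{\mathbf{p}}\in\mathbb{C}^B,\ \|\tilde{\mathbf{p}}\|_2=1,\ \ \tilde{\mathbf{H}}_{\mathbf{P}}\in\mathbb{C}^{B\times U},\ \ \tilde{\mathbf{S}}_D\in\mathcal{S}^{U\times D}}\ \big\|(\mathbf{I}_B-\tilde{\mathbf{p}}\tilde{\mathbf{p}}^{\mathrm H})\mathbf{Y}-\tilde{\mathbf{H}}_{\mathbf{P}}\,[\mathbf{S}_T,\tilde{\mathbf{S}}_D]\big\|_F^2$$ has the solution $(\hat{\mathbf{p}},\hat{\mathbf{H}}_{\mathbf{P}},\hat{\mathbf{S}}_D)=(\mathbf{p},\mathbf{P}\mathbf{H},\mathbf{S}_D)$,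 and this solution is unique up to a phase shift of $\hat{\mathbf{p}}$; that is, the set of minimizers is exactly $\{(\alpha\mathbf{p},\mathbf{P}\mathbf{H},\mathbf{S}_D):\alpha\in\mathbb{C},\ |\alpha|=1\}$.
   Context: $B,U,T,D$ are positive integers. $\mathcal{S}\subset\mathbb{C}$ is a constellation, i.e., a finite set with at least two elements, normalized to unit average symbol energy ($\frac{1}{|\mathcal{S}|}\sum_{s\in\mathcal{S}}|s|^2=1$). $\mathbf{H}$ is the user channel matrix, $\mathbf{j}$ the channel vector of a single-antenna jammer, $\mathbf{S}_T$ the (known) pilot matrix, $\mathbf{S}_D$ the data matrix, and $\mathbf{w}$ the jammer's transmit sequence. $(\cdot)^{\mathrm T}$, $(\cdot)^{\mathrm H}$ and $(\cdot)^\dagger$ denote transpose, conjugate transpose and Moore–Penrose pseudoinverse; $\|\cdot\|_F$ is the Frobenius norm. Definition (eclipsed). Given $\mathbf{S}_T,\mathbf{S}_D,\mathbf{w}_T,\mathbf{w}_D$, the jammer is *eclipsed* if there exists a matrix $\tilde{\mathbf{S}}_D\in\mathcal{S}^{U\times D}$ with $\tilde{\mathbf{S}}_D\neq\mathbf{S}_D$ such that the $(U+1)\times D$ matrix $$\boldsymbol{\Sigma}=\begin{bmatrix}\mathbf{S}_D-\tilde{\mathbf{S}}_D\\ \mathbf{w}_D^{\mathrm T}-\mathbf{w}_T^{\mathrm T}\mathbf{S}_T^{\dagger}\tilde{\mathbf{S}}_D\end{bmatrix}$$ has rank one. *)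

(* Defs.v *)
From HB Require Import structures.
From mathcomp Require Import all_boot all_order all_algebra.
From mathcomp Require Import spectral finmap.
From mathcomp Require Import boolp classical_sets reals complex.

Set Implicit Arguments.
Unset Strict Implicit.
Unset Printing Implicit Defensive.

Import Order.TTheory GRing.Theory Num.Theory.

Local Open Scope ring_scope.
Local Open Scope sesquilinear_scope.

(* The definitions are over an arbitrary [C : numClosedFieldType], of which
   [R[i]] with [R : realType] is an instance.  As with [`|x|], the norms below
   are (real, nonnegative) elements of [C]; the partial order of [C] restricts
   to the usual order on real elements. *)

Definition norm2 (C : numClosedFieldType) (n : nat) (v : 'cV[C]_n) : C :=
  sqrtC (\sum_i `|v i 0| ^+ 2).

Definition normF (C : numClosedFieldType) (m n : nat) (A : 'M[C]_(m, n)) : C :=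
  sqrtC (\sum_i \sum_j `|A i j| ^+ 2).

Definition penrose (C : numClosedFieldType) (m n : nat)
    (A : 'M[C]_(m, n)) (X : 'M[C]_(n, m)) : Prop :=
  [/\ A *m X *m A = A, X *m A *m X = X,
      (A *m X)^t* = A *m X & (X *m A)^t* = X *m A].

(* Lemmas [pinvmP] and [pinvm_unique] show that the default value [0] is never
   used.  The library's [pinvmx] is only some generalized inverse, not the
   Moore-Penrose one. *)
Definition pinvm (C : numClosedFieldType) (m n : nat) (A : 'M[C]_(m, n)) :
  'M[C]_(n, m) := xget 0 [set X | penrose A X]%classic.

Lemma trmxC_mul (C : numClosedFieldType) (m n p : nat)
    (A : 'M[C]_(m, n)) (B : 'M[C]_(n, p)) : (A *m B)^t* = B^t* *m A^t*.
Proof. by rewrite trmx_mul map_mxM. Qed.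

Lemma mulmx_trmxC_eq0 (C : numClosedFieldType) (m n : nat)
    (A : 'M[C]_(m, n)) : A *m A^t* = 0 -> A = 0.
Proof.
move=> h; apply/matrixP => i j; rewrite mxE; apply/eqP.
have /matrixP/(_ i i) := h; rewrite !mxE => /eqP.
rewrite psumr_eq0; last by move=> k _; rewrite !mxE -normCK exprn_ge0.
move/allP/(_ j); rewrite mem_index_enum => /(_ isT) /=.
by rewrite !mxE mulf_eq0 conjC_eq0 orbb.
Qed.

Lemma gram_unitmx (C : numClosedFieldType) (m n : nat) (A : 'M[C]_(m, n)) :
  row_free A -> A *m A^t* \in unitmx.
Proof.
move=> fA; rewrite -row_free_unit -kermx_eq0; apply/eqP.
set K := kermx _; have KA : K *m (A *m A^t*) = 0 by exact: mulmx_ker.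
have : (K *m A) *m (K *m A)^t* = 0.
  by rewrite trmxC_mul mulmxA -(mulmxA K) KA mul0mx.
by move/mulmx_trmxC_eq0 => /eqP; rewrite mulmx_free_eq0 // => /eqP.
Qed.

Lemma trmxC_invmx (C : numClosedFieldType) (n : nat) (A : 'M[C]_n) :
  (invmx A)^t* = invmx (A^t*).
Proof. by rewrite trmx_inv map_invmx. Qed.

Lemma penrose_factor (C : numClosedFieldType) (m n r : nat)
    (L : 'M[C]_(m, r)) (F : 'M[C]_(r, n)) :
  row_full L -> row_free F ->
  penrose (L *m F)
    (F^t* *m invmx (F *m F^t*) *m (invmx (L^t* *m L) *m L^t*)).
Proof.
move=> fL fF; have uF := gram_unitmx fF.
have uL : L^t* *m L \in unitmx.
  have {2}-> : L = (L^t*)^t* by rewrite trmxCK.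
  by apply: gram_unitmx; rewrite /row_free mxrank_map mxrank_tr.
set G := invmx (F *m F^t*); set K := invmx (L^t* *m L).
have GE : F *m F^t* *m G = 1%:M by rewrite mulmxV.
have KE : K *m (L^t* *m L) = 1%:M by rewrite mulVmx.
have Gh : G^t* = G by rewrite trmxC_invmx trmxC_mul trmxCK.
have Kh : K^t* = K by rewrite trmxC_invmx trmxC_mul trmxCK.
set X := _ *m (_ *m _).
have AX : L *m F *m X = L *m (K *m L^t*).
  by rewrite /X -mulmxA; congr (L *m _); rewrite !mulmxA GE mul1mx.
have XA : X *m (L *m F) = F^t* *m G *m F.
  by rewrite /X -mulmxA (mulmxA (K *m _)) -(mulmxA K) KE mul1mx.
split.
- by rewrite AX -mulmxA (mulmxA (K *m _)) -(mulmxA K) KE mul1mx.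
- by rewrite XA /X -!mulmxA (mulmxA F) (mulmxA (F *m F^t*)) GE mul1mx.
- by rewrite AX !trmxC_mul trmxCK Kh mulmxA.
- by rewrite XA !trmxC_mul trmxCK Gh mulmxA.
Qed.

Lemma penrose_ex (C : numClosedFieldType) (m n : nat) (A : 'M[C]_(m, n)) :
  exists X, penrose A X.
Proof.
have := penrose_factor (col_base_full A) (row_base_free A).
by rewrite mulmx_base; eexists; eassumption.
Qed.

Lemma pinvmP (C : numClosedFieldType) (m n : nat) (A : 'M[C]_(m, n)) :
  penrose A (pinvm A).
Proof. exact/(@xgetPex _ 0 [set X | penrose A X]%classic)/penrose_ex. Qed.

Lemma pinvm_unique (C : numClosedFieldType) (m n : nat) (A : 'M[C]_(m, n))
    (X : 'M[C]_(n, m)) : penrose A X -> X = pinvm A.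
Proof.
case: (pinvmP A); set Y := pinvm A => Y1 Y2 Y3 Y4 [X1 X2 X3 X4].
have XY : A *m X = A *m Y.
  have -> : A *m X = A *m Y *m (A *m X) by rewrite mulmxA Y1.
  by rewrite -[LHS]trmxCK trmxC_mul X3 Y3 mulmxA X1 Y3.
have YX : X *m A = Y *m A.
  have -> : X *m A = X *m A *m (Y *m A) by rewrite -mulmxA (mulmxA A) Y1.
  by rewrite -[LHS]trmxCK trmxC_mul X4 Y4 -mulmxA (mulmxA A) X1 Y4.
by rewrite -X2 YX -mulmxA XY mulmxA Y2.
Qed.

Definition orthproj (C : numClosedFieldType) (n : nat) (p : 'cV[C]_n) :
  'M[C]_n := 1%:M - p *m p^t*.

Definition constellation (C : numClosedFieldType) (calS : {fset C}) : Prop :=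
  (2 <= #|` calS|)%N /\ (#|` calS|%:R)^-1 * \sum_(s <- calS) `|s| ^+ 2 = 1.

Definition eclipsed (C : numClosedFieldType) (calS : {fset C}) (U T D : nat)
    (ST : 'M[C]_(U, T)) (SD : 'M[C]_(U, D)) (wT : 'cV[C]_T) (wD : 'cV[C]_D) :
    Prop :=
  exists SD' : 'M[C]_(U, D),
    [/\ SD' \is a mxOver (mem calS), SD' <> SD &
        \rank (col_mx (SD - SD') (wD^T - wT^T *m pinvm ST *m SD')) = 1%N].

Definition objective (C : numClosedFieldType) (B U T D : nat)
    (Y : 'M[C]_(B, T + D)) (ST : 'M[C]_(U, T))
    (p : 'cV[C]_B) (HP : 'M[C]_(B, U)) (SD : 'M[C]_(U, D)) : C :=
  normF (orthproj p *m Y - HP *m row_mx ST SD) ^+ 2.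

Definition feasible (C : numClosedFieldType) (calS : {fset C}) (B U D : nat)
    (p : 'cV[C]_B) (HP : 'M[C]_(B, U)) (SD : 'M[C]_(U, D)) : Prop :=
  norm2 p = 1 /\ SD \is a mxOver (mem calS).

Definition minimizer (C : numClosedFieldType) (calS : {fset C})
    (B U T D : nat) (Y : 'M[C]_(B, T + D)) (ST : 'M[C]_(U, T))
    (p : 'cV[C]_B) (HP : 'M[C]_(B, U)) (SD : 'M[C]_(U, D)) : Prop :=
  feasible calS p HP SD /\
  forall (p' : 'cV[C]_B) (HP' : 'M[C]_(B, U)) (SD' : 'M[C]_(U, D)),
    feasible calS p' HP' SD' ->
    objective Y ST p HP SD <= objective Y ST p' HP' SD'.

(* Main.v *)
(** The objective vanishes at [(p, P H, S_D)], so the minimizers are the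
    feasible zeros.  At a zero, the pilot block forces
    [H' = P' (H + j w_T^T S_T^+)], and the data block becomes
    [P' [H, j] Sigma = 0] where [P'] has a kernel of dimension one and [[H, j]]
    has full column rank; hence [Sigma] has rank at most one, and not being
    eclipsed forces [S_D' = S_D].  Then [P' j (w_D^T - w_T^T S_T^+ S_D) = 0],
    where the row vector is nonzero: otherwise, changing a single entry of
    [S_D] would give a [Sigma] of rank one.  So [P' j = 0]. *)
Require Import Defs.
From mathcomp Require Import all_boot all_order all_algebra.
From mathcomp Require Import spectral finmap.
From mathcomp Require Import boolp classical_sets reals complex.

Import Order.TTheory GRing.Theory Num.Theory.

Local Open Scope ring_scope.
Local Open Scope sesquilinear_scope.

Section MinimizersOfTheNoiselessProblem.

Set Implicit Arguments.
Unset Strict Implicit.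

(** * Matrices of full column rank *)

Lemma mxrank_mul_row_full (F : fieldType) (m n p : nat)
    (A : 'M[F]_(m, n)) (X : 'M[F]_(n, p)) :
  row_full A -> \rank (A *m X) = \rank X.
Proof.
move=> fA; rewrite -mxrank_tr trmx_mul mxrankMfree ?mxrank_tr //.
by rewrite /row_free mxrank_tr.
Qed.

(** For a kernel vector [(x, y)] of [[A, v]], a nonzero [y] would put [v] in the column space of
    [A]; if [y = 0], full column rank of [A] forces [x = 0]. *)
Lemma row_full_row_mx (F : fieldType) (m n : nat)
    (A : 'M[F]_(m, n)) (v : 'cV[F]_m) :
  row_full A -> ~ (exists x : 'cV[F]_n, v = A *m x) -> row_full (row_mx A v).
Proof.
move=> fA nv; suff: row_free (row_mx A v)^T by rewrite /row_free mxrank_tr.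
apply: inj_row_free => u; rewrite -[u]hsubmxK; set x := lsubmx u; set y := rsubmx u.
rewrite tr_row_mx mul_row_col => /(congr1 trmx).
rewrite linearD /= !trmx_mul !trmxK trmx0 => xy0.
have yE : y^T = (y 0 0)%:M by rewrite {1}[y]mx11_scalar tr_scalar_mx.
rewrite yE mul_mx_scalar in xy0.
have [y0|y0] := eqVneq (y 0 0) 0.
  rewrite y0 scale0r addr0 in xy0.
  have -> : y = 0 by rewrite [y]mx11_scalar y0 raddf0.
  suff -> : x = 0 by rewrite row_mx0.
  have: x *m A^T = 0 by rewrite -[LHS]trmxK trmx_mul trmxK xy0 trmx0.
  have fAT : row_free A^T by rewrite /row_free mxrank_tr.
  by move/eqP; rewrite mulmx_free_eq0 // => /eqP.
case: nv; exists (- (y 0 0)^-1 *: x^T).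
move/eqP: xy0; rewrite addrC addr_eq0 => /eqP xy0.
by rewrite -scalemxAr scaleNr -scalerN -xy0 scalerK.
Qed.

Variable C : numClosedFieldType.

(** * Frobenius and Euclidean norms *)

Lemma normF_sqr (m n : nat) (A : 'M[C]_(m, n)) :
  normF A ^+ 2 = \sum_i \sum_j `|A i j| ^+ 2.
Proof. exact: sqrtCK. Qed.

Lemma normF_sqr_ge0 (m n : nat) (A : 'M[C]_(m, n)) : 0 <= normF A ^+ 2.
Proof.
by rewrite normF_sqr sumr_ge0 // => i _; rewrite sumr_ge0 // => k _; rewrite exprn_ge0.
Qed.

Lemma normF_sqr_eq0 (m n : nat) (A : 'M[C]_(m, n)) :
  (normF A ^+ 2 == 0) = (A == 0).
Proof.
apply/eqP/eqP => [|->]; last first.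
  by rewrite normF_sqr big1 // => i _; rewrite big1 // => k _; rewrite mxE normr0 expr0n.
rewrite normF_sqr => /eqP; rewrite psumr_eq0 => [|i _]; last first.
  by rewrite sumr_ge0 // => k _; rewrite exprn_ge0.
move/allP => A0; apply/matrixP => i k; rewrite mxE.
have /= := A0 i (mem_index_enum _); rewrite psumr_eq0 => [/allP Ai0|l _]; last first.
  by rewrite exprn_ge0.
by have /= := Ai0 k (mem_index_enum _); rewrite sqrf_eq0 normr_eq0 => /eqP.
Qed.

Lemma norm2_sqr (n : nat) (v : 'cV[C]_n) : v^t* *m v = (norm2 v ^+ 2)%:M.
Proof.
rewrite [LHS]mx11_scalar sqrtCK; congr (_%:M); rewrite mxE.
by apply: eq_bigr => i _; rewrite !mxE normCK mulrC.
Qed.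

Lemma norm2_ge0 (n : nat) (v : 'cV[C]_n) : 0 <= norm2 v.
Proof. by rewrite sqrtC_ge0 sumr_ge0 // => i _; rewrite exprn_ge0. Qed.

Lemma norm2_eq0 (n : nat) (v : 'cV[C]_n) : (norm2 v == 0) = (v == 0).
Proof.
have -> : norm2 v = normF v by congr sqrtC; apply: eq_bigr => i _; rewrite big_ord1.
by rewrite -normF_sqr_eq0 sqrf_eq0.
Qed.

Lemma norm2Z (n : nat) (a : C) (v : 'cV[C]_n) : norm2 (a *: v) = `|a| * norm2 v.
Proof.
apply/eqP; rewrite -(@eqrXn2 _ 2) ?mulr_ge0 ?norm2_ge0 // exprMn !sqrtCK mulr_sumr.
by apply/eqP; apply: eq_bigr => i _; rewrite mxE normrM exprMn.
Qed.

Lemma norm2_normalize (n : nat) (v : 'cV[C]_n) :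
  v != 0 -> norm2 ((norm2 v)^-1 *: v) = 1.
Proof.
rewrite -norm2_eq0 => v0.
by rewrite norm2Z ger0_norm ?invr_ge0 ?norm2_ge0 // mulVf.
Qed.

(** * The projectors [I - p p^H] *)

Lemma orthproj_self (n : nat) (p : 'cV[C]_n) : norm2 p = 1 -> orthproj p *m p = 0.
Proof.
by move=> p1; rewrite mulmxBl mul1mx -mulmxA norm2_sqr p1 expr1n mulmx1 subrr.
Qed.

(** The phase cancels against its conjugate in [p p^H]; this is the source of the phase freedom in
    the minimizers. *)
Lemma orthprojZ (n : nat) (a : C) (p : 'cV[C]_n) :
  `|a| = 1 -> orthproj (a *: p) = orthproj p.
Proof.
move=> a1; rewrite /orthproj linearZ /= map_mxZ -scalemxAl -scalemxAr scalerA.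
by rewrite -normCK a1 expr1n scale1r.
Qed.

(** The hypothesis reads [p = b q] with [b = q^H p]; the unit norms give [|b| = 1], so [a = b^-1] is
    a phase. *)
Lemma orthproj_eq0 (n : nat) (p q : 'cV[C]_n) :
  norm2 p = 1 -> norm2 q = 1 -> orthproj q *m p = 0 ->
  exists2 a, `|a| = 1 & q = a *: p.
Proof.
move=> p1 q1; rewrite mulmxBl mul1mx -mulmxA [q^t* *m p]mx11_scalar mul_mx_scalar.
set b := (_ *m _) 0 0 => /eqP; rewrite subr_eq0 => /eqP pE.
have b1 : `|b| = 1 by rewrite -p1 pE norm2Z q1 mulr1.
have b0 : b != 0 by rewrite -normr_eq0 b1 oner_eq0.
by exists b^-1; [rewrite normfV b1 invr1 | rewrite pE scalerK].
Qed.

(** Such an [X] equals [q (q^H X)], a product through dimension one. *)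
Lemma rank_orthproj_ker (m n : nat) (q : 'cV[C]_m) (X : 'M[C]_(m, n)) :
  orthproj q *m X = 0 -> (\rank X <= 1)%N.
Proof.
rewrite mulmxBl mul1mx -mulmxA => /eqP; rewrite subr_eq0 => /eqP ->.
exact: mulmx_max_rank.
Qed.

(** * Pseudoinverse, constellation and eclipsing *)

Lemma mulmx_pinvm (m n : nat) (A : 'M[C]_(m, n)) :
  row_free A -> A *m pinvm A = 1%:M.
Proof.
by move=> fA; have [AXA _ _ _] := pinvmP A; apply: (row_free_inj fA); rewrite AXA mul1mx.
Qed.

(** Removing [s] from at least two symbols leaves one, which supplies the altered entry in
    [eclipsed_aligned]. *)
Lemma constellation_neq (calS : {fset C}) (s : C) :
  constellation calS -> exists2 t, t \in calS & t != s.
Proof.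
case=> S2 _; have: (0 < #|` (calS `\ s)%fset|)%N.
  by move: S2; rewrite (cardfsD1 s); case: (s \in calS) => //; apply: leq_trans.
by rewrite cardfs_gt0 => /fset0Pn[t]; rewrite !inE => /andP[ts tS]; exists t.
Qed.

Lemma eclipsed_aligned (calS : {fset C}) (U T D : nat) (ST : 'M[C]_(U, T))
    (SD : 'M[C]_(U, D)) (wT : 'cV[C]_T) (wD : 'cV[C]_D) :
  (0 < U)%N -> (0 < D)%N -> constellation calS -> SD \is a mxOver (mem calS) ->
  wD^T = wT^T *m pinvm ST *m SD -> eclipsed calS ST SD wT wD.
Proof.
move=> U0 D0 cS /mxOverP SDS wDE.
pose i0 := Ordinal U0; pose k0 := Ordinal D0.
have [t tS tn] := constellation_neq (SD i0 k0) cS.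
pose SD' := \matrix_(i, k) if (i == i0) && (k == k0) then t else SD i k.
have dE : SD - SD' = (SD i0 k0 - t) *: delta_mx i0 k0.
  apply/matrixP => i k; rewrite !mxE; case: ifP => [/andP[/eqP-> /eqP->]|_].
    by rewrite mulr1.
  by rewrite subrr mulr0.
have c0 : SD i0 k0 - t != 0 by rewrite subr_eq0 eq_sym.
exists SD'; split.
- by apply/mxOverP => i k; rewrite mxE; case: ifP.
- move=> E; move: tn; rewrite -E mxE !eqxx /=; exact/negP/negPn.
(* Sigma factors as [[I; wT^T ST^+] (SD - SD')], where the difference is a nonzero multiple of a
   matrix unit. *)
- rewrite wDE -mulmxBr -[X in col_mx X _]mul1mx -mul_col_mx mxrank_mul_row_full.
    by rewrite dE mxrank_scale_nz // mxrank_delta.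
  (* The identity block alone already gives the left factor rank [U]. *)
  rewrite /row_full eqn_leq rank_leq_col /= -{1}(mxrank1 C U).
  by apply: mxrankS; rewrite -addsmxE addsmxSl.
Qed.

(** * Zeros and minimizers of the objective *)

Section Problem.
Variables (B U T D : nat) (calS : {fset C}) (H : 'M[C]_(B, U)) (j : 'cV[C]_B).
Variables (ST : 'M[C]_(U, T)) (SD : 'M[C]_(U, D)) (wT : 'cV[C]_T) (wD : 'cV[C]_D).

Let Y := H *m row_mx ST SD + j *m (col_mx wT wD)^T.

Lemma objective_ge0 (p : 'cV[C]_B) (HP : 'M[C]_(B, U)) (SD' : 'M[C]_(U, D)) :
  0 <= objective Y ST p HP SD'.
Proof. exact: normF_sqr_ge0. Qed.

Lemma objective_eq0P (p : 'cV[C]_B) (HP : 'M[C]_(B, U)) (SD' : 'M[C]_(U, D)) :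
  objective Y ST p HP SD' = 0 <->
  orthproj p *m (H *m ST + j *m wT^T) = HP *m ST /\
  orthproj p *m (H *m SD + j *m wD^T) = HP *m SD'.
Proof.
have E : orthproj p *m Y - HP *m row_mx ST SD' =
    row_mx (orthproj p *m (H *m ST + j *m wT^T) - HP *m ST)
           (orthproj p *m (H *m SD + j *m wD^T) - HP *m SD').
  by rewrite /Y tr_col_mx !mul_mx_row add_row_mx mul_mx_row opp_row_mx add_row_mx.
rewrite /objective E; split=> [/eqP|[-> ->]]; last first.
  by apply/eqP; rewrite normF_sqr_eq0 !subrr row_mx0.
by rewrite normF_sqr_eq0 row_mx_eq0 !subr_eq0 => /andP[/eqP ? /eqP ?].
Qed.

Hypotheses (U0 : (0 < U)%N) (D0 : (0 < D)%N) (cS : constellation calS).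
Hypotheses (fH : row_full H) (njH : ~ (exists x : 'cV[C]_U, j = H *m x)).
Hypotheses (fST : row_free ST) (SDS : SD \is a mxOver (mem calS)).
Hypothesis (nec : ~ eclipsed calS ST SD wT wD).

(** A general [q] is allowed so that all rotations of the normalized [j] are covered. *)
Lemma objective_truth_eq0 (q : 'cV[C]_B) :
  orthproj q *m j = 0 -> objective Y ST q (orthproj q *m H) SD = 0.
Proof.
move=> qj; apply/objective_eq0P.
by rewrite !mulmxDr !mulmxA qj !mul0mx !addr0.
Qed.

Lemma objective_eq0_truth (q : 'cV[C]_B) (HP : 'M[C]_(B, U)) (SD' : 'M[C]_(U, D)) :
  SD' \is a mxOver (mem calS) -> objective Y ST q HP SD' = 0 ->
  [/\ orthproj q *m j = 0, HP = orthproj q *m H & SD' = SD].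
Proof.
move=> SDS' /objective_eq0P[pilot data].
set X := pinvm ST; set Q := orthproj q in pilot data *.
(* Right multiplication of the pilot equation by [X] isolates [HP], since [ST *m X = 1%:M]. *)
have HPE : HP = Q *m (H + j *m wT^T *m X).
  by rewrite -[LHS]mulmx1 -(mulmx_pinvm fST) mulmxA -pilot -mulmxA mulmxDl -mulmxA
             mulmx_pinvm // mulmx1.
set Sigma := col_mx (SD - SD') (wD^T - wT^T *m X *m SD').
(* By [HPE], the data equation says that [Q] kills [(H SD + j wD^T) - (H + j wT^T X) SD'], which is
   [[H, j] Sigma]. *)
have QSigma : Q *m (row_mx H j *m Sigma) = 0.
  move/eqP: data; rewrite HPE -mulmxA -subr_eq0 -mulmxBr => /eqP <-.
  congr (Q *m _).
  by rewrite mul_row_col mulmxDl !mulmxBr !mulmxA opprD addrACA.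
have rSigma : (\rank Sigma <= 1)%N.
  rewrite -(mxrank_mul_row_full Sigma (row_full_row_mx fH njH)).
  exact: rank_orthproj_ker QSigma.
have SDE : SD' = SD.
  apply: contrapT => SDn; apply: nec; exists SD'; split=> //.
  (* Rank zero is excluded because the upper block [SD - SD'] is nonzero. *)
  apply/eqP; rewrite eqn_leq rSigma lt0n mxrank_eq0 col_mx_eq0 negb_and subr_eq0.
  by apply/orP; left; apply/eqP => E; apply: SDn.
have Qj : Q *m j = 0.
  have v0 : wD^T - wT^T *m X *m SD != 0.
    rewrite subr_eq0; apply/eqP => /(eclipsed_aligned U0 D0 cS SDS).
    exact: nec.
  (* The upper block of [Sigma] now vanishes, leaving [(Q j) v = 0]; a nonzero row [v] has rank one
     and cancels on the right. *)
  move: QSigma; rewrite /Sigma SDE subrr mul_row_col mulmx0 add0r mulmxA => /eqP.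
  by rewrite mulmx_free_eq0 /row_free ?rank_rV ?v0 // => /eqP.
by split=> //; rewrite HPE mulmxDr !mulmxA Qj !mul0mx addr0.
Qed.

Lemma minimizerP (p : 'cV[C]_B) (HP : 'M[C]_(B, U)) (SD' : 'M[C]_(U, D)) :
  let p0 := (norm2 j)^-1 *: j in
  minimizer calS Y ST p HP SD' <->
  exists alpha : C,
    [/\ `|alpha| = 1, p = alpha *: p0, HP = orthproj p0 *m H & SD' = SD].
Proof.
move=> p0; have j0 : j != 0.
  by apply/eqP => j0; apply: njH; exists 0; rewrite mulmx0.
have p01 : norm2 p0 = 1 by exact: norm2_normalize.
have jE : j = norm2 j *: p0 by rewrite scalerKV // norm2_eq0.
have Pj : orthproj p0 *m j = 0 by rewrite jE -scalemxAr orthproj_self ?scaler0.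
have obj0 := objective_truth_eq0 Pj.
split=> [[[p1 SDS'] opt]|[a [a1 -> -> ->]]].
  have objp : objective Y ST p HP SD' = 0.
    (* Comparison with the true parameters bounds the value above by zero. *)
    by apply/le_anti; rewrite objective_ge0 -obj0 opt.
  have [Qj HPE ->] := objective_eq0_truth SDS' objp.
  have [|a a1 pE] := orthproj_eq0 p01 p1.
    by rewrite /p0 -scalemxAr Qj scaler0.
  by exists a; split=> //; rewrite HPE pE orthprojZ.
split; first by split=> //; rewrite norm2Z a1 p01 mulr1.
move=> p' HP' SD2 _.
(* Replacing [orthproj p0] by [orthproj (a *: p0)] makes [objective_truth_eq0] apply with
   [q = a *: p0]. *)
by rewrite -(orthprojZ p0 a1) objective_truth_eq0 ?objective_ge0 // orthprojZ.
Qed.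

End Problem.
End MinimizersOfTheNoiselessProblem.

Local Open Scope complex_scope.

Theorem theorem1 (R : realType) (B U T D : nat) (calS : {fset R[i]})
    (H : 'M[R[i]]_(B, U)) (j : 'cV[R[i]]_B)
    (ST : 'M[R[i]]_(U, T)) (SD : 'M[R[i]]_(U, D)) (w : 'cV[R[i]]_(T + D)) :
  (0 < B)%N -> (0 < U)%N -> (0 < T)%N -> (0 < D)%N ->
  constellation calS ->
  \rank H = U ->
  ~ (exists x : 'cV[R[i]]_U, j = H *m x) ->
  \rank ST = U ->
  SD \is a mxOver (mem calS) ->
  let wT : 'cV[R[i]]_T := usubmx w in
  let wD : 'cV[R[i]]_D := dsubmx w in
  let Y : 'M[R[i]]_(B, T + D) := H *m row_mx ST SD + j *m w^T in
  let p : 'cV[R[i]]_B := (norm2 j)^-1 *: j in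
  let P : 'M[R[i]]_B := orthproj p in
  ~ eclipsed calS ST SD wT wD ->
  minimizer calS Y ST p (P *m H) SD /\
  forall (p' : 'cV[R[i]]_B) (HP' : 'M[R[i]]_(B, U)) (SD' : 'M[R[i]]_(U, D)),
    minimizer calS Y ST p' HP' SD' <->
    exists alpha : R[i],
      [/\ `|alpha| = 1, p' = alpha *: p, HP' = P *m H & SD' = SD].
Proof.
move=> _ U0 _ D0 cS rH njH rST SDS wT wD Y p P nec.
have fH : row_full H by rewrite /row_full rH.
have fST : row_free ST by rewrite /row_free rST.
have minP := @minimizerP R[i] B U T D calS H j ST SD wT wD U0 D0 cS fH njH fST SDS nec.
(* Gluing the halves of [w] back together identifies the receive matrix of [minimizerP] with [Y]. *)
rewrite /wT /wD vsubmxK in minP.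
split; last exact: minP.
apply/minP; exists 1; split=> //; [exact: normr1 | by rewrite scale1r].
Qed.
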